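(* Consider the noisy HK system with global information (S3) under assumption (A1), with $r_{\min}<1$. For $\eta>r_{\min}/2$ let $\underline\omega_\eta=\min\{\omega_i: r_i<2\eta\}$ and $c^2_\eta=\max\big\{2\eta,\min\{\tfrac{n\eta}{(n-1)\underline\omega_\eta},n\eta\}\big\}$. Then for every initial state $x(0)\in[0,1]^n$, almost surely $\overline d_{\mathcal V}=2\eta$ if $\eta\le r_{\min}/2$, and $\overline d_{\mathcal V}\ge\min\{c^2_\eta,1\}$ if $\eta>r_{\min}/2$. Moreover, for any $\alpha>0$ let $c^3_\alpha=2\eta-\alpha$ if $\eta\le r_{\min}/2$ and $c^3_\alpha=\min\{c^2_\eta-\alpha,1\}$ if $\eta>r_{\min}/2$; let $\tau_0=0$ and for $k\ge1$, $\tau_k=\min\{s>\tau_{k-1}:d_{\mathcal V}(s)\le\alpha\}$ if $k$ is odd and $\tau_k=\min\{s>\tau_{k-1}:d_{\mathcal V}(s)\ge c^3_\alpha\}$ if $k$ is even. Then there are constants $\lambda_3\in(0,1)$, $\Lambda_3>0$ depending only on $n,\eta,\underline\rho,\alpha$ and $\omega_i,r_i$ ($i\in\mathcal V$) such that $P(\tau_{k+1}-\tau_k>t)\le(1-\lambda_3)^{\lfloor t/\Lambda_3\rfloor}$ for all $k\ge0$, $t\ge0$.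
   Context: Fix an integer $n\ge3$, agent set $\mathcal V=\{1,\dots,n\}$, confidence thresholds $r_i\in(0,1]$, $r_{\min}=\min_i r_i$, belief factors $\omega_i\in(0,1)$, and a noise amplitude $\eta>0$. Opinions $x_i(t)\in[0,1]$, $x(t)=(x_1(t),\dots,x_n(t))$, $t=0,1,\dots$, arbitrary initial state $x(0)\in[0,1]^n$. Neighbor set $\mathcal N_i(t)=\{j\in\mathcal V:|x_j(t)-x_i(t)|\le r_i\}$ (contains $i$), $\Pi_{[0,1]}(y)=\min\{1,\max\{0,y\}\}$, $x_{\rm ave}(t)=\frac1n\sum_{i=1}^nx_i(t)$, $d_{\mathcal V}(t)=\max_{i,j}|x_i(t)-x_j(t)|$, $\overline d_{\mathcal V}=\limsup_{t\to\infty}d_{\mathcal V}(t)$. System (S3): for all $i\in\mathcal V$, $t\ge0$, $x_i(t+1)=\Pi_{[0,1]}\big(\omega_ix_{\rm ave}(t)+\frac{1-\omega_i}{|\mathcal N_i(t)|}\sum_{j\in\mathcal N_i(t)}x_j(t)+\xi_i(t)\big)$ with random noises $\xi_i(t)\in[-\eta,\eta]$. Assumption (A1): there is a constant $\underline\rho>0$ such that for every $t\ge0$, given any states $x(0),\dots,x(t)\in[0,1]^n$, $P\big(\bigcap_{i=1}^n\{\xi_i(t)\in[a_i,b_i]\}\,\big|\,x(0),\dots,x(t)\big)\ge\underline\rho\prod_{i=1}^n(b_i-a_i)$ for all reals $-\eta\le a_i<b_i\le\eta$. *)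

(* Defs.v *)
From HB Require Import structures.
From mathcomp Require Import all_boot all_order all_algebra.
From mathcomp Require Import all_classical all_reals all_analysis.
Set Implicit Arguments. Unset Strict Implicit. Unset Printing Implicit Defensive.
Import Order.TTheory GRing.Theory Num.Theory.
Local Open Scope ring_scope.
Local Open Scope classical_set_scope.

Section HK.
Variables (R : realType) (n : nat).

Definition proj01 (y : R) : R := Num.min 1 (Num.max 0 y).

Definition x_ave (x : 'I_n -> R) : R := (n%:R)^-1 * \sum_(i < n) x i.

Definition nbr (r : 'I_n -> R) (x : 'I_n -> R) (i : 'I_n) : {set 'I_n} :=
  [set j | `|x j - x i| <= r i].

Definition hk_step (r om : 'I_n -> R) (x e : 'I_n -> R) : 'I_n -> R :=
  fun i => proj01 (om i * x_ave x
                   + (1 - om i) / (#|nbr r x i|)%:R * \sum_(j in nbr r x i) x j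
                   + e i).

Fixpoint hk_traj (r om : 'I_n -> R) (x0 : 'I_n -> R) (xi : nat -> 'I_n -> R)
    (t : nat) : 'I_n -> R :=
  match t with
  | 0%N => x0
  | t'.+1 => hk_step r om (hk_traj r om x0 xi t') (xi t')
  end.

Definition diam (x : 'I_n -> R) : R :=
  \big[Num.max/0]_(i < n) \big[Num.max/0]_(j < n) `|x i - x j|.

Definition rmin (r : 'I_n -> R) : R := \big[Num.min/1]_(i < n) r i.

(* underline omega_eta = min { omega_i : r_i < 2 eta } (the set is nonempty
   when eta > r_min/2; all omega_i < 1 so the neutral element 1 is harmless) *)
Definition om_eta (r om : 'I_n -> R) (eta : R) : R :=
  \big[Num.min/1]_(i < n | r i < 2 * eta) om i.

Definition c2 (r om : 'I_n -> R) (eta : R) : R :=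
  Num.max (2 * eta)
    (Num.min (n%:R * eta / ((n%:R - 1) * om_eta r om eta)) (n%:R * eta)).

Definition c3 (r om : 'I_n -> R) (eta alpha : R) : R :=
  if eta <= rmin r / 2 then 2 * eta - alpha
  else Num.min (c2 r om eta - alpha) 1.

(* first time s > m with Q s ; None encodes +infinity (no such time) *)
Definition first_after (Q : pred nat) (m : nat) : option nat :=
  match pselect (exists s, (m < s)%N && Q s) with
  | left h => Some (ex_minn h)
  | right _ => None
  end.

(* tau_k for a sequence dv(t) = d_V(t); None = +infinity *)
Fixpoint hk_tau (dv : nat -> R) (alpha c : R) (k : nat) : option nat :=
  match k with
  | 0%N => Some 0%N
  | k'.+1 =>
    match hk_tau dv alpha c k' with
    | None => None
    | Some m =>
      if odd k'.+1 then first_after (fun s => dv s <= alpha) m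
      else first_after (fun s => c <= dv s) m
    end
  end.

End HK.

(* Main.v *)
Require Import Defs.
From HB Require Import structures.
From mathcomp Require Import all_boot all_order all_algebra.
From mathcomp Require Import all_classical all_reals all_analysis.
From mathcomp Require Import measurable_realfun ring lra.
Import Order.TTheory GRing.Theory Num.Theory.
Set Implicit Arguments. Unset Strict Implicit. Unset Printing Implicit Defensive.
Local Open Scope ring_scope.
Local Open Scope classical_set_scope.

(* By (A1), any prescribed finite sequence of noise boxes of a fixed side is
   followed with probability bounded below, whatever the past; so a set of
   states that such a sequence forces the system into, from every state, is hit
   after geometrically tailed times. No feedback is needed. Noise close to -eta
   brings all agents to exactly 0 in finitely many steps, because the projection
   clips them there: this is consensus. From 0, one step lifts everybody to a
   common level c ~ min(eta, 1/2), and one more step pushes an agent i up by eta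
   while the others fall back to exactly 0, giving a diameter close to
   min(1, 2 eta). If r_i < 2 eta, agent i is now isolated; keeping its noise near
   eta and the others' near -eta, the others stay at 0 while the diameter d < n eta
   of the system obeys d' ~ min(1, d - omega_i d (n-1)/n + eta), which increases
   up to n eta / ((n-1) omega_i). Finally, when 2 eta <= r_min, a diameter at most
   r_min makes everybody a neighbor of everybody, so that the next diameter is at
   most 2 eta, and this persists. *)

(** * Archimedean bounds, first hitting times, criteria for null events and limsups *)

Lemma natr_mul_ge (R : realType) (y beta : R) : 0 < beta -> exists k : nat, y <= k%:R * beta.
Proof.
move=> b0; exists (Num.truncn (`|y| / beta)).+1.
rewrite -ler_pdivrMr// ltW//; apply: le_lt_trans (truncnS_gt _).
by rewrite ler_pM2r ?invr_gt0// ler_norm.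
Qed.

Lemma exists_pos_le4 (R : realType) (a b c d : R) : 0 < a -> 0 < b -> 0 < c -> 0 < d ->
  exists e : R, [/\ 0 < e, e <= a, e <= b, e <= c & e <= d].
Proof.
move=> a0 b0 c0 d0; exists (Num.min a (Num.min b (Num.min c d))).
by split; rewrite ?lt_min ?ge_min ?a0 ?b0 ?c0 ?d0 ?lexx ?orbT.
Qed.

Lemma first_after_someP (Q : pred nat) (m u : nat) :
  first_after Q m = Some u <->
  [/\ (m < u)%N, Q u & forall v, (m < v < u)%N -> ~~ Q v].
Proof.
rewrite /first_after; case: pselect => [exQ|noQ]; last first.
  by split=> // -[mu Qu _]; case: noQ; exists u; rewrite mu.
case: ex_minnP => k /andP[mk Qk] kmin; split => [[<-]|[mu Qu umin]].
  split=> // v /andP[mv vk]; apply/negP => Qv.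
  by have := kmin v; rewrite mv Qv leqNgt vk => /(_ isT).
congr Some; apply/eqP; rewrite eqn_leq kmin ?mu//= leqNgt; apply/negP => ku.
by have := umin k; rewrite mk ku Qk => /(_ isT).
Qed.

Lemma first_after_le (Q : pred nat) (m v : nat) : (m < v)%N -> Q v ->
  exists2 u, first_after Q m = Some u & (u <= v)%N.
Proof.
move=> mv Qv; rewrite /first_after; case: pselect => [exQ|noQ]; last first.
  by case: noQ; exists v; rewrite mv.
by case: ex_minnP => k _ kmin; exists k => //; apply: kmin; rewrite mv.
Qed.

(** Applied to probabilities: an event missed by $j$ successive trials for every $j$ is null. *)
Lemma le_exprn_eq0 (R : realType) (q : R) (x : \bar R) :
  0 <= q < 1 -> (0 <= x)%E -> (forall j, x <= (q ^+ j)%:E)%E -> x = 0%E.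
Proof.
move=> /andP[q0 q1] x0 xq; apply/eqP; rewrite eq_le x0 andbT.
apply/lee_addgt0Pr => e e0; rewrite add0e.
have qn1 : `|q| < 1 by rewrite ger0_norm.
have [j _ /(_ j (leqnn j)) /= qje] := cvgr_lt _ (cvg_expr qn1) e e0.
by apply: le_trans (xq j) _; rewrite lee_fin ltW.
Qed.

Lemma limn_esup_ge (R : realType) (u : nat -> R) (c : R) :
  (forall m, exists2 k, (m < k)%N & c <= u k) ->
  (c%:E <= limn_esup (fun k => (u k)%:E))%E.
Proof.
move=> uc; apply: le_ereal_inf_tmp => _ [V [m _ mV] <-].
have [k mk ck] := uc m; apply: (@le_trans _ _ (u k)%:E); first by rewrite lee_fin.
by apply: ereal_sup_ubound; exists k => //; apply: mV => /=; exact: ltnW.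
Qed.

Lemma limn_esup_le (R : realType) (u : nat -> R) (c : R) m :
  (forall k, (m <= k)%N -> u k <= c) ->
  (limn_esup (fun k => (u k)%:E) <= c%:E)%E.
Proof.
move=> uc; apply: (@le_trans _ _
  (ereal_sup ((fun k => (u k)%:E) @` [set k | (m <= k)%N]))).
  by apply: ereal_inf_lbound; exists [set k | (m <= k)%N] => //; exists m.
by apply: ge_ereal_sup => _ [k mk <-]; rewrite lee_fin; exact: uc.
Qed.

(** * Deterministic steering *)

Section Projection.
Variable R : realType.
Implicit Types y c : R.

Lemma proj01_ge y c : c <= 1 -> c <= y -> c <= proj01 y.
Proof. by move=> c1 cy; rewrite /proj01 le_min c1 le_max cy orbT. Qed.

Lemma proj01_le y c : 0 <= c -> y <= c -> proj01 y <= c.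
Proof. by move=> c0 yc; rewrite /proj01 ge_min ge_max c0 yc orbT. Qed.

Lemma proj01_bounds y : 0 <= proj01 y <= 1.
Proof. by rewrite /proj01 le_min ler01 le_max lexx ge_min lexx. Qed.

(** One-sided form of the fact that the projection is nonexpansive. Either $z\ge1$ and [proj01 z] is
    already maximal, or $z\le$ [proj01 z]. *)
Lemma proj01_leD y z c : 0 <= c -> y <= z + c -> proj01 y <= proj01 z + c.
Proof.
move=> c0 yzc; have /andP[z0 _] := proj01_bounds z.
have [z1|/ltW z1] := leP 1 z.
  have /andP[_ y1] := proj01_bounds y.
  by have := proj01_ge (lexx 1) z1; lra.
by have zz := proj01_ge z1 (lexx z); apply: proj01_le; lra.
Qed.

End Projection.

(** * The noise-free update and the diameter *)

Section Mean.
Variables (R : realType) (n : nat) (r om : 'I_n -> R).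
Hypotheses (r_ge0 : forall i, 0 <= r i) (om01 : forall i, 0 <= om i <= 1).
Implicit Types (x : 'I_n -> R) (i j : 'I_n).

Definition hk_mean x i : R :=
  om i * x_ave x + (1 - om i) / (#|nbr r x i|)%:R * \sum_(j in nbr r x i) x j.

Lemma hk_stepE x e i : hk_step r om x e i = proj01 (hk_mean x i + e i).
Proof. by []. Qed.

Lemma nbr_refl x i : i \in nbr r x i.
Proof. by rewrite inE subrr normr0. Qed.

Lemma card_nbr_gt0 x i : 0 < (#|nbr r x i|)%:R :> R.
Proof. by rewrite ltr0n; apply/card_gt0P; exists i; exact: nbr_refl. Qed.

Lemma ord_natr_gt0 i : 0 < n%:R :> R.
Proof. by rewrite ltr0n; apply: leq_trans (ltn_ord i). Qed.

(** [hk_mean] is a convex combination of the global average and of an average over a nonempty set,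
    since each agent is its own neighbor. *)
Lemma hk_mean_le x i c : (forall j, x j <= c) -> hk_mean x i <= c.
Proof.
move=> xc; have /andP[om_ge0 om_le1] := om01 i.
have -> : c = om i * c + (1 - om i) * c by ring.
apply: lerD.
  rewrite ler_wpM2l// /x_ave mulrC ler_pdivrMr ?(ord_natr_gt0 i)//.
  apply: le_trans (ler_sum _ (fun j _ => xc j)) _.
  by rewrite sumr_const card_ord mulr_natr.
rewrite -mulrA ler_wpM2l ?subr_ge0// mulrC ler_pdivrMr ?card_nbr_gt0//.
apply: le_trans (ler_sum _ (fun j _ => xc j)) _.
by rewrite sumr_const mulr_natr.
Qed.

Lemma hk_mean_ge x i c : (forall j, c <= x j) -> c <= hk_mean x i.
Proof.
move=> xc; have /andP[om_ge0 om_le1] := om01 i.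
have -> : c = om i * c + (1 - om i) * c by ring.
apply: lerD.
  rewrite ler_wpM2l// /x_ave mulrC ler_pdivlMr ?(ord_natr_gt0 i)//.
  apply: le_trans (ler_sum _ (fun j _ => xc j)).
  by rewrite sumr_const card_ord mulr_natr.
rewrite -mulrA ler_wpM2l ?subr_ge0// mulrC ler_pdivlMr ?card_nbr_gt0//.
apply: le_trans (ler_sum _ (fun j _ => xc j)).
by rewrite sumr_const mulr_natr.
Qed.

Lemma hk_mean_full x i : nbr r x i = [set: 'I_n]%SET -> hk_mean x i = x_ave x.
Proof.
move=> N; rewrite /hk_mean N cardsT card_ord.
rewrite (eq_bigl xpredT) => [|j]; last by rewrite inE.
rewrite /x_ave; ring.
Qed.

Lemma x_ave_single x i : (forall j, j != i -> x j = 0) -> x_ave x = x i / n%:R.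
Proof.
move=> x0; rewrite /x_ave (bigD1 i)//= big1 ?addr0 1?mulrC//.
Qed.

(** The local average is then the agent's own state; only the global average pulls it down, by
    $\omega_i x_i(n-1)/n$. *)
Lemma hk_mean_isolated x i : (forall j, j != i -> x j = 0) -> r i < x i ->
  hk_mean x i = om i * (x i / n%:R) + (1 - om i) * x i.
Proof.
move=> x0 rx; rewrite /hk_mean (x_ave_single x0).
suff -> : nbr r x i = [set i]%SET by rewrite cards1 big_set1 divr1.
apply/setP => j; rewrite !inE; case: (eqVneq j i) => [->|ji].
  by rewrite subrr normr0 r_ge0.
rewrite x0// sub0r normrN gtr0_norm ?leNgt ?rx//.
exact: le_lt_trans rx.
Qed.

(** If agent $j$ at 0 sees the peak, it sees everybody and its mean is the global average $x_i/n$.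
    Otherwise its local average is 0 and $\omega_j x_i/n$ remains. *)
Lemma hk_mean_others x i j : (forall j, j != i -> x j = 0) -> 0 <= x i ->
  j != i -> hk_mean x j <= x i / n%:R.
Proof.
move=> x0 xi0 ji; case: (boolP (i \in nbr r x j)) => iN.
  rewrite hk_mean_full ?(x_ave_single x0)//.
  apply/setP => k; rewrite [RHS]inE; case: (eqVneq k i) => [->//|ki].
  by rewrite inE !x0// subrr normr0 r_ge0.
rewrite /hk_mean big1 => [|k kN]; last first.
  by rewrite x0//; apply: contra iN => /eqP <-.
rewrite mulr0 addr0 (x_ave_single x0); have /andP[om_ge0 om_le1] := om01 j.
by rewrite ler_piMl// divr_ge0// ler0n.
Qed.

Lemma diam_norm_ge x i j : `|x i - x j| <= diam x.
Proof.
rewrite /diam; apply: le_trans (le_bigmax _ _ i).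
exact: (le_bigmax 0 (fun j => `|x i - x j|)).
Qed.

Lemma diam_ge x i j : x i - x j <= diam x.
Proof. exact: le_trans (ler_norm _) (diam_norm_ge x i j). Qed.

Lemma diam_le x c : 0 <= c -> (forall i j, `|x i - x j| <= c) -> diam x <= c.
Proof. by move=> c0 xc; apply: bigmax_le => // i _; apply: bigmax_le. Qed.

Lemma rmin_le i : rmin r <= r i.
Proof. exact: bigmin_le. Qed.

(** All agents are mutual neighbors, so all means equal the global average and only the noises, at
    most $2\eta$ apart, separate the new states. *)
Lemma diam_step_le x e eta : diam x <= rmin r -> 0 <= eta ->
  (forall i, - eta <= e i <= eta) -> diam (hk_step r om x e) <= 2 * eta.
Proof.
move=> dr eta0 eb; apply: diam_le => [|i j]; first lra.
have full k : hk_mean x k = x_ave x.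
  apply: hk_mean_full; apply/setP => l; rewrite !inE.
  exact: le_trans (diam_norm_ge _ _ _) (le_trans dr (rmin_le k)).
rewrite !hk_stepE !full.
have /andP[? ?] := eb i; have /andP[? ?] := eb j.
have ? : proj01 (x_ave x + e i) <= proj01 (x_ave x + e j) + 2 * eta.
  by apply: proj01_leD; lra.
have ? : proj01 (x_ave x + e j) <= proj01 (x_ave x + e i) + 2 * eta.
  by apply: proj01_leD; lra.
by rewrite ler_norml; apply/andP; split; lra.
Qed.

End Mean.

(** * Open-loop steering and its elementary moves *)

Section Steering.
Variables (R : realType) (n : nat) (r om : 'I_n -> R) (eta : R).
Hypotheses (r_ge0 : forall i, 0 <= r i) (om01 : forall i, 0 <= om i <= 1).
Implicit Types (lo hi a x e : 'I_n -> R) (G : set ('I_n -> R)) (beta c v h : R).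

Definition box lo hi : set ('I_n -> R) := [set x | forall j, lo j <= x j <= hi j].

(* From any state of [box lo hi], a predetermined (open-loop) sequence of noise
   boxes of side [beta] leads to [G] within [L] steps. *)
Fixpoint steers (beta : R) G (L : nat) lo hi : Prop :=
  match L with
  | 0%N => box lo hi `<=` G
  | L'.+1 => exists a lo' hi',
     [/\ forall j, - eta <= a j /\ a j + beta <= eta,
         forall x e, box lo hi x -> ~ G x ->
           box a (fun j => a j + beta) e -> box lo' hi' (hk_step r om x e)
       & steers beta G L' lo' hi']
  end.

(** Noise at most $-\eta+\beta$ lowers the upper bound by $\eta-\beta$ per step, and clipping makes
    the final state exactly 0, with no residual error. *)
Lemma steers_down beta G L k h : 0 < beta -> beta < eta -> 0 <= h ->
  h <= k%:R * (eta - beta) ->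
  steers beta G L (cst 0) (cst 0) -> steers beta G (k + L) (cst 0) (cst h).
Proof.
move=> b0 be h0 + HL; elim: k h h0 => [|k IHk] h h0 hk.
  by rewrite mul0r in hk; have -> : h = 0 by apply/eqP; rewrite eq_le hk h0.
pose h' := Num.max 0 (h - (eta - beta)).
exists (cst (- eta)), (cst 0), (cst h'); split.
- by move=> j /=; split; lra.
- move=> x e xb _ eb j /=; rewrite hk_stepE.
  have /andP[-> _] /= := proj01_bounds (hk_mean r om x j + e j).
  apply: proj01_le; first by rewrite le_max lexx.
  rewrite le_max; apply/orP; right.
  have : hk_mean r om x j <= h.
    by apply: hk_mean_le => // k'; have /andP[_ +] := xb k'.
  by have /= /andP[_ ?] := eb j; lra.
- apply: IHk; first by rewrite le_max lexx.
  rewrite ge_max; apply/andP; split.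
    by rewrite mulr_ge0 ?ler0n// subr_ge0 ltW.
  rewrite -natr1 mulrDl mul1r in hk; lra.
Qed.

(** At consensus on 0 every mean is 0, so the new state is the clipped noise. *)
Lemma steers_lift beta G L c : 0 < beta -> 0 <= c -> c <= 1 ->
  c + beta <= eta ->
  steers beta G L (cst c) (cst (c + beta)) ->
  steers beta G L.+1 (cst 0) (cst 0).
Proof.
move=> b0 c0 c1 cb HL; exists (cst c), (cst c), (cst (c + beta)); split=> //.
  by move=> j /=; split; lra.
move=> x e xb _ eb j /=; rewrite hk_stepE.
have ? : hk_mean r om x j <= 0.
  by apply: hk_mean_le => // k; have /andP[_ +] := xb k.
have ? : 0 <= hk_mean r om x j.
  by apply: hk_mean_ge => // k; have /andP[+ _] := xb k.
have /= /andP[? ?] := eb j.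
by apply/andP; split; [apply: proj01_ge|apply: proj01_le]; lra.
Qed.

Definition peak (i : 'I_n) (v : R) : 'I_n -> R := fun j => if j == i then v else 0.

Lemma peakE (i : 'I_n) v w x : box (peak i v) (peak i w) x ->
  v <= x i <= w /\ forall j, j != i -> x j = 0.
Proof.
move=> xb; split; first by have := xb i; rewrite /peak eqxx.
move=> j ji; have := xb j; rewrite /peak (negbTE ji) => /andP[? ?].
by apply/eqP; rewrite eq_le; apply/andP.
Qed.

Let split_noise (i : 'I_n) (beta : R) : 'I_n -> R :=
  fun j => if j == i then eta - beta else - eta.

Lemma split_noise_ok (i : 'I_n) beta j : 0 < beta -> beta <= eta ->
  - eta <= split_noise i beta j /\ split_noise i beta j + beta <= eta.
Proof. by move=> ? ?; rewrite /split_noise; case: eqP => _; split; lra. Qed.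

(** The condition $c+\beta\le\eta-\beta$ makes the largest possible value of the other agents
    nonpositive before projection, so they land exactly on 0. *)
Lemma steers_split beta G L c v (i : 'I_n) : 0 < beta -> 0 <= c ->
  c + beta <= eta - beta -> v <= 1 -> v <= c + (eta - beta) ->
  steers beta G L (peak i v) (peak i 1) ->
  steers beta G L.+1 (cst c) (cst (c + beta)).
Proof.
move=> b0 c0 cb v1 vc HL; exists (split_noise i beta), (peak i v), (peak i 1).
split=> //; first by move=> j; apply: split_noise_ok => //; lra.
move=> x e xb _ eb j; rewrite hk_stepE.
have ? : hk_mean r om x j <= c + beta.
  by apply: hk_mean_le => // k; have /andP[_ +] := xb k.
have ? : c <= hk_mean r om x j.
  by apply: hk_mean_ge => // k; have /andP[+ _] := xb k.
have := eb j; rewrite /peak /split_noise /=; case: eqP => _ /andP[? ?].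
  have /andP[_ ->] := proj01_bounds (hk_mean r om x j + e j).
  by rewrite andbT; apply: proj01_ge => //; lra.
have /andP[-> _] /= := proj01_bounds (hk_mean r om x j + e j).
by apply: proj01_le => //; lra.
Qed.

(* The state of the isolated agent [i] grows by [beta] at each step, while the
   projection keeps the other agents at 0. *)
Lemma steers_climb beta c (i i' : 'I_n) k v :
  i' != i -> 0 < beta -> beta <= eta -> c <= 1 -> 0 <= v -> v <= 1 ->
  (v < 1 -> r i < v) ->
  c / n%:R <= eta - beta -> om i * (c * (1 - n%:R^-1)) <= eta - 2 * beta ->
  c <= v + k%:R * beta ->
  steers beta [set x | c <= diam x] k (peak i v) (peak i 1).
Proof.
move=> i'i b0 be c1 + + + cn comega; elim: k v => [|k IHk] v v0 v1 rv cv.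
  move=> x /peakE[/andP[vx _] x0] /=; apply: le_trans (diam_ge _ i i').
  by rewrite mul0r in cv; rewrite (x0 _ i'i); lra.
pose v' := Num.min 1 (v + beta).
exists (split_noise i beta), (peak i v'), (peak i 1); split.
- by move=> j; apply: split_noise_ok.
- move=> x e /peakE[/andP[vx x1] x0] /= /negP; rewrite -ltNge => dxc eb j.
  (* Off target, the peak is below [c]: this bounds both the pull on agent [i] and the mean of the
     others by their values at [c]. *)
  have xc : x i < c.
    by apply: le_lt_trans dxc; have := diam_ge x i i'; rewrite (x0 _ i'i) subr0.
  have xi0 : 0 <= x i by lra.
  have n0 : 0 <= (n%:R^-1 : R) by rewrite invr_ge0 ler0n.
  have n1 : (n%:R^-1 : R) <= 1.
    by rewrite invf_le1 ?ler1n ?ltr0n; apply: leq_trans (ltn_ord i).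
  rewrite hk_stepE; have := eb j; rewrite /peak /split_noise.
  have /andP[p0 p1] := proj01_bounds (hk_mean r om x j + e j).
  case: eqP => [->|/eqP ji] /andP[el eu]; last first.
    rewrite p0 /=; apply: proj01_le => //.
    have := hk_mean_others r_ge0 om01 x0 xi0 ji.
    have : x i / n%:R <= c / n%:R by rewrite ler_wpM2r// ltW.
    lra.
  apply/andP; split; last by case/andP: (proj01_bounds (hk_mean r om x i + e i)).
  apply: proj01_ge; first by rewrite ge_min lexx.
  rewrite ge_min; apply/orP; right.
  (* Isolation: $v\le x_i<c\le1$, so the hypothesis $r_i<v$ is available. *)
  rewrite hk_mean_isolated//; last by exact: lt_le_trans (rv (le_lt_trans vx (lt_le_trans xc c1))) vx.
  have -> : om i * (x i / n%:R) + (1 - om i) * x i =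
            x i - om i * (x i * (1 - n%:R^-1)) by ring.
  have : om i * (x i * (1 - n%:R^-1)) <= om i * (c * (1 - n%:R^-1)).
    have /andP[om_ge0 _] := om01 i.
    by rewrite ler_wpM2l// ler_wpM2r ?subr_ge0// ltW.
  by move: comega el; lra.
- apply: IHk.
  + by rewrite le_min ler01 /=; lra.
  + by rewrite ge_min lexx.
  + by rewrite /v' gt_min ltxx /= => vb; rewrite lt_min; apply/andP; split; lra.
  + rewrite -natr1 mulrDl mul1r in cv.
    have : 0 <= k%:R * beta by rewrite mulr_ge0 ?ler0n// ltW.
    by rewrite /v'; case: (leP 1 (v + beta)) => _; lra.
Qed.

End Steering.

(** * Steering to consensus and to a large diameter *)

Section Targets.
Variables (R : realType) (n : nat) (r om : 'I_n -> R) (eta : R).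
Hypotheses (n_ge3 : (3 <= n)%N) (r01 : forall i, 0 < r i <= 1).
Hypothesis om01 : forall i, 0 < om i < 1.
Hypothesis eta_gt0 : 0 < eta.

Let r_ge0 i : 0 <= r i. Proof. by have /andP[/ltW] := r01 i. Qed.
Let omW i : 0 <= om i <= 1. Proof. by have /andP[/ltW -> /ltW] := om01 i. Qed.

Lemma steers_consensus (alpha : R) : 0 < alpha -> exists (beta : R) (L : nat), 0 < beta /\
  steers r om eta beta [set x | diam x <= alpha] L (cst 0) (cst 1).
Proof.
move=> a0; have e0 := eta_gt0; have e2 : 0 < eta - eta / 2 by lra.
have [k hk] := natr_mul_ge 1 e2.
exists (eta / 2), (k + 0)%N; split; first lra.
apply: steers_down => //; try lra.
move=> x xb /=; apply: diam_le => [|i j]; first exact: ltW.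
have /= /andP[? ?] := xb i; have /= /andP[? ?] := xb j.
rewrite ler_norml; lra.
Qed.

(** Selects the agent that will climb. An agent attaining [rmin] shows that there are candidates;
    the default values 1 of both minima are harmless because $r_i,\omega_i\le1$. *)
Lemma om_eta_attained : rmin r / 2 < eta ->
  exists2 i, r i < 2 * eta & om i = om_eta r om eta.
Proof.
move=> re; have e0 := eta_gt0.
have [i ri] : exists i, r i < 2 * eta.
  have i0 : 'I_n by exact: Ordinal (leq_trans (isT : 0 < 3)%N n_ge3).
  have [i _ rminE] : {i | i \in xpredT & rmin r = r i}.
    by apply: eq_bigmin => // i _; have /andP[] := r01 i.
  by exists i; rewrite -rminE; lra.
rewrite /om_eta; have [j jr ->] := @eq_bigmin _ _ _ 1 i (fun i => r i < 2 * eta) om ri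
  (fun i _ => proj2 (andP (omW i))).
by exists j.
Qed.

(* The intermediate level [c] is as high as possible under the constraint that
   the noise can then bring the agents other than [i] to 0 in one step. *)
Lemma steers_to_peak (beta : R) G L (i : 'I_n) : 0 < beta -> 4 * beta <= eta ->
  steers r om eta beta G L
    (peak i (Num.min 1 (2 * eta - 3 * beta))) (peak i 1) ->
  exists L', steers r om eta beta G L' (cst 0) (cst 1).
Proof.
move=> b0 be HL; have e0 := eta_gt0; have e2 : 0 < eta - beta by lra.
have [k hk] := natr_mul_ge 1 e2; exists (k + L.+2)%N.
apply: steers_down => //; first lra.
pose c := Num.min (eta - 2 * beta) 2^-1.
have c0 : 0 <= c by rewrite le_min; apply/andP; split; lra.
have cl : c <= eta - 2 * beta by rewrite ge_min lexx.
have c2 : c <= 2^-1 by rewrite ge_min lexx orbT.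
apply: (@steers_lift _ _ _ _ _ _ _ _ _ _ c) => //; try lra.
apply: steers_split HL => //; try lra; first by rewrite ge_min lexx.
(* For $c=\eta-2\beta$ the peak reaches $2\eta-3\beta$; for $c=1/2<\eta-2\beta$ it reaches 1. *)
by rewrite ge_min /c; case: (leP (eta - 2 * beta) 2^-1) => ?; apply/orP; [right|left]; lra.
Qed.

(** If the required diameter is at most $\min(1,2\eta-\alpha)$, the peak alone suffices. Otherwise
    $c^2_\eta>2\eta$, and the agent with the smallest $\omega_i$ among those with $r_i<2\eta$ climbs
    from the peak. *)
Lemma steers_spread (alpha : R) : 0 < alpha -> exists (beta : R) (L : nat), 0 < beta /\
  steers r om eta beta [set x | c3 r om eta alpha <= diam x] L (cst 0) (cst 1).
Proof.
move=> a0; have e0 := eta_gt0.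
have i0 : 'I_n by exact: Ordinal (leq_trans (isT : 0 < 3)%N n_ge3).
have other (i : 'I_n) : exists i', i' != i.
  have [e|e] := eqVneq (i : nat) 0%N.
    by exists (Ordinal (leq_trans (isT : 1 < 3)%N n_ge3)); rewrite -val_eqE /= e.
  by exists (Ordinal (leq_trans (isT : 0 < 3)%N n_ge3)); rewrite -val_eqE /= eq_sym.
have easy : c3 r om eta alpha <= Num.min 1 (2 * eta - alpha) ->
  exists (beta : R) (L : nat), 0 < beta /\
  steers r om eta beta [set x | c3 r om eta alpha <= diam x] L (cst 0) (cst 1).
  (* The peak loses $3\beta\le\alpha$, and [steers_to_peak] asks for $4\beta\le\eta$. *)
  move=> c3_le; exists (Num.min (eta / 4) (alpha / 4)).
  set beta := Num.min _ _.
  have [b0 [b1 b2]] : 0 < beta /\ beta <= eta / 4 /\ beta <= alpha / 4.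
    by rewrite lt_min !ge_min !lexx orbT; split=> //; apply/andP; split; lra.
  have [L HL] : exists L, steers r om eta beta
      [set x | c3 r om eta alpha <= diam x] L (cst 0) (cst 1).
    apply: (@steers_to_peak _ _ 0 i0) => //; first lra.
    have [i' i'i] := other i0.
    move=> x /peakE[/andP[xi _] x0] /=; apply: le_trans (diam_ge _ i0 i').
    rewrite (x0 _ i'i) subr0; apply: le_trans xi; apply: le_trans c3_le _.
    by rewrite le_min !ge_min !lexx /=; apply/orP; right; lra.
  by exists L.
have n3 : 3 <= n%:R :> R by rewrite ler_nat.
case: (leP eta (rmin r / 2)) => re.
  apply: easy; rewrite /c3 re le_min lexx andbT.
  have /andP[_ ?] := r01 i0; have := rmin_le r i0; lra.
have c3E : c3 r om eta alpha = Num.min (c2 r om eta - alpha) 1.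
  by rewrite /c3 leNgt re.
have [i ri omi] := om_eta_attained re.
have [ce|ce] := leP (c2 r om eta) (2 * eta).
  by apply: easy; rewrite c3E le_min !ge_min lexx orbT /=; apply/orP; left; lra.
have /andP[om0 om1] := om01 i.
have [c_om c_n] : c2 r om eta <= n%:R * eta / ((n%:R - 1) * om i) /\
                  c2 r om eta <= n%:R * eta.
  move: ce; rewrite omi /c2 lt_max ltxx /= => /ltW ce.
  by rewrite (max_r ce) !ge_min !lexx orbT.
have nm0 : 0 < n%:R - 1 :> R by lra.
(* The bounds serve, in order: reaching the peak; a peak height $2\eta-3\beta$ above $r_i$; keeping
   the others at 0, as $c/n\le\eta-\alpha/n$; and a gain of $\beta$ per step, as the pull on agent
   [i] is at most $\eta-\alpha\omega_i(n-1)/n$. *)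
have [beta [b0 b1 b2 b3 b4]] : exists beta : R, [/\ 0 < beta, beta <= eta / 4,
    beta <= (2 * eta - r i) / 4, beta <= alpha / n%:R &
    beta <= alpha * om i * (n%:R - 1) / n%:R / 2].
  apply: exists_pos_le4; [lra|lra| |].
    by rewrite divr_gt0//; lra.
  by rewrite !divr_gt0 ?mulr_gt0//; lra.
have [i' i'i] := other i.
pose v := Num.min 1 (2 * eta - 3 * beta); pose c := c3 r om eta alpha.
have c1 : c <= 1 by rewrite /c c3E ge_min lexx orbT.
have cc : c <= c2 r om eta - alpha by rewrite /c c3E ge_min lexx.
have [k hk] := natr_mul_ge c b0; exists beta.
suff [L HL] : exists L, steers r om eta beta
    [set x | c3 r om eta alpha <= diam x] L (cst 0) (cst 1) by exists L.
have r0 := r_ge0 i.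
have v0 : 0 <= v by rewrite le_min ler01 /=; lra.
apply: (@steers_to_peak _ _ k i) => //; first lra.
apply: (steers_climb r_ge0 omW i'i) => //; first lra.
- by rewrite ge_min lexx.
- by rewrite -/v gt_min ltxx /= => v1; rewrite lt_min; apply/andP; split; lra.
- rewrite ler_pdivrMr; last lra.
  move: b3; rewrite ler_pdivlMr; last lra.
  by rewrite -/c; lra.
- have -> : 1 - n%:R^-1 = (n%:R - 1) / n%:R :> R.
    by field; apply/eqP; lra.
  have : om i * (c * ((n%:R - 1) / n%:R)) <=
    om i * ((n%:R * eta / ((n%:R - 1) * om i) - alpha) * ((n%:R - 1) / n%:R)).
    rewrite ler_pM2l// ler_wpM2r//; last lra.
    by rewrite divr_ge0//; lra.
  have -> : om i * ((n%:R * eta / ((n%:R - 1) * om i) - alpha) *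
      ((n%:R - 1) / n%:R)) = eta - alpha * om i * (n%:R - 1) / n%:R.
    by field; apply/and3P; split; apply/eqP; lra.
  rewrite -/c; lra.
- by rewrite -/c -/v; lra.
Qed.

End Targets.

(** * Hitting probabilities *)

Section Measurability.
Variables (R : realType) (n : nat) (r om : 'I_n -> R).
Variables (d : measure_display) (T : measurableType d).

(** Meant for the neighbor set, which takes finitely many values: once it is frozen, the mean is
    linear in the state. *)
Lemma measurable_fun_finpart (K : finType) (k : T -> K) (g : K -> T -> R) :
  (forall a, measurable [set w | k w = a]) ->
  (forall a, measurable_fun setT (g a)) ->
  measurable_fun setT (fun w => g (k w) w).
Proof.
move=> mk mg _ Y mY; rewrite setTI.
have -> : (fun w => g (k w) w) @^-1` Y =
    \bigcup_(a in [set: K]) ([set w | k w = a] `&` (setT `&` g a @^-1` Y)).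
  apply/seteqP; split => [w Yw|w [a _ [/= <- []//]]].
  by exists (k w).
apply: fin_bigcup_measurable => [|a _]; first exact: finite_finset.
by apply: measurableI => //; exact: mg.
Qed.

Lemma measurable_fun_bigmaxr (I : Type) (s : seq I) (h : I -> T -> R) :
  (forall i, measurable_fun setT (h i)) ->
  measurable_fun setT (fun w => \big[Num.max/0]_(i <- s) h i w).
Proof.
move=> mh; elim: s => [|i s IHs].
  by under eq_fun do rewrite big_nil; exact: measurable_cst.
by under eq_fun do rewrite big_cons; exact: measurable_maxr.
Qed.

Variable X : T -> 'I_n -> R.
Hypothesis mX : forall i, measurable_fun setT (fun w => X w i).

Lemma measurable_dist i j : measurable_fun setT (fun w => `|X w i - X w j|).
Proof. by apply: measurableT_comp => //; exact: measurable_funB. Qed.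

Lemma measurable_diam : measurable_fun setT (fun w => diam (X w)).
Proof.
apply: measurable_fun_bigmaxr => i; apply: measurable_fun_bigmaxr => j.
exact: measurable_dist.
Qed.

Lemma measurable_nbr_eq i (A : {set 'I_n}) :
  measurable [set w | nbr r (X w) i = A].
Proof.
have -> : [set w | nbr r (X w) i = A] = \bigcap_(j in [set: 'I_n])
    (setT `&` (fun w => `|X w j - X w i| <= r i) @^-1` [set (j \in A)]).
  apply/seteqP; split => [w /= <- j _|w H /=]; first by rewrite inE.
  by apply/setP => j; have [_ /=] := H j I; rewrite inE.
apply: fin_bigcap_measurable => [|j _]; first exact: finite_finset.
have mf : measurable_fun setT (fun w => `|X w j - X w i| <= r i).
  by apply: measurable_fun_ler => //; exact: measurable_dist.
exact: mf.
Qed.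

Lemma measurable_hk_mean i : measurable_fun setT (fun w => hk_mean r om (X w) i).
Proof.
apply: (@measurable_fun_finpart _ (fun w => nbr r (X w) i) (fun A w =>
  om i * x_ave (X w) + (1 - om i) / #|A|%:R * \sum_(j in A) X w j)) => A.
  exact: measurable_nbr_eq.
have mS : measurable_fun setT (fun w => \sum_(j in A) X w j).
  rewrite (_ : (fun w => _) = fun w => \sum_j (if j \in A then X w j else 0)).
    by apply: measurable_sum => j; case: (j \in A).
  by apply/funext => w; rewrite big_mkcond.
apply: measurable_funD; apply: measurable_funM => //.
by apply: measurable_funM => //; exact: measurable_sum.
Qed.

Lemma measurable_hk_step (e : 'I_n -> T -> R) i : measurable_fun setT (e i) ->
  measurable_fun setT (fun w => hk_step r om (X w) (e^~ w) i).
Proof.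
move=> me; apply: measurable_minr => //; apply: measurable_maxr => //.
by apply: measurable_funD => //; exact: measurable_hk_mean.
Qed.

Lemma measurable_box lo hi : measurable [set w | box lo hi (X w)].
Proof.
have -> : [set w | box lo hi (X w)] = \bigcap_(j in [set: 'I_n])
    (setT `&` (fun w => X w j) @^-1` `[lo j, hi j]%classic).
  apply/seteqP; split => [w H j _|w H j]; first by split=> //=; rewrite in_itv /= H.
  by have [_ /=] := H j I; rewrite in_itv.
apply: fin_bigcap_measurable => [|j _]; first exact: finite_finset.
by apply: mX => //; exact: measurable_itv.
Qed.

Lemma measurable_diam_le c : measurable [set w | diam (X w) <= c].
Proof.
have -> : [set w | diam (X w) <= c] =
    setT `&` (fun w => diam (X w)) @^-1` `]-oo, c]%classic.
  by rewrite setTI; apply/seteqP; split => w /=; rewrite in_itv.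
by apply: measurable_diam => //; exact: measurable_itv.
Qed.

Lemma measurable_diam_ge c : measurable [set w | c <= diam (X w)].
Proof.
have -> : [set w | c <= diam (X w)] =
    setT `&` (fun w => diam (X w)) @^-1` `[c, +oo[%classic.
  by rewrite setTI; apply/seteqP; split => w /=; rewrite in_itv /= andbT.
by apply: measurable_diam => //; exact: measurable_itv.
Qed.

End Measurability.

(** * The trajectory, the sigma-algebras of its past, and hit rates *)

Section Process.
Variables (R : realType) (n : nat) (r om : 'I_n -> R) (eta rho : R).
Variables (d : measure_display) (T : measurableType d) (P : probability T R).
Variables (xi : nat -> 'I_n -> T -> R) (x0 : 'I_n -> R).

Let X t w : 'I_n -> R := hk_traj r om x0 (fun u j => xi u j w) t.

(** Generators of $\sigma(x(0),\dots,x(t))$, in the very form used in the statement of the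
    theorem. *)
Definition hk_gen (t : nat) : set (set T) :=
  [set A | exists (s : nat) (i : 'I_n) (U : set R),
     (s <= t)%N /\ measurable U /\
     A = (fun w => hk_traj r om x0 (fun u j => xi u j w) s i) @^-1` U].

Local Notation F t := (<<s hk_gen t >>).

Hypothesis mxi : forall t i, measurable_fun setT (xi t i).
Hypothesis x0_01 : forall i, 0 <= x0 i <= 1.
Hypothesis A1 : forall (t : nat) (a b : 'I_n -> R),
  (forall i, - eta <= a i /\ a i < b i /\ b i <= eta) ->
  forall B : set T, F t B ->
  ((rho * \prod_(i < n) (b i - a i))%:E * P B
     <= P ([set w | forall i, (a i <= xi t i w <= b i)%R] `&` B))%E.

Lemma measurable_traj t i : measurable_fun setT (fun w => X t w i).
Proof.
elim: t i => [|t IHt] i; first exact: measurable_cst.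
exact: (@measurable_hk_step _ _ _ _ _ _ (X t) IHt (xi t)).
Qed.

Lemma traj_box t w : box (cst 0) (cst 1) (X t w).
Proof. by case: t => [|t] i //=; exact: proj01_bounds. Qed.

Lemma hk_gen_measurable t A : F t A -> measurable A.
Proof.
apply: smallest_sub => [|B [s [i [U [_ [mU ->]]]]]].
  split; [exact: measurable0 | by move=> B mB; apply: measurableD |].
  by move=> B mB; exact: bigcupT_measurable.
by rewrite -[X in measurable X]setTI; exact: measurable_traj.
Qed.

Lemma hk_gen_mono s t : (s <= t)%N -> F s `<=` F t.
Proof.
move=> st A; apply: smallest_sub => [|B [u [i [U [us mU]]]]].
  exact: smallest_sigma_algebra.
by apply: sub_sigma_algebra; exists u, i, U; split=> //; exact: leq_trans st.
Qed.

Lemma traj_adapted s t i : (s <= t)%N ->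
  @measurable_fun _ _ (g_sigma_algebraType (hk_gen t)) R setT (fun w => X s w i).
Proof.
move=> st _ U mU; rewrite setTI; apply: sub_sigma_algebra.
by exists s, i, U.
Qed.

Lemma hk_genI t A B : F t A -> F t B -> F t (A `&` B).
Proof. exact: (@measurableI _ (g_sigma_algebraType (hk_gen t))). Qed.

Lemma hk_genU t A B : F t A -> F t B -> F t (A `|` B).
Proof. exact: (@measurableU _ (g_sigma_algebraType (hk_gen t))). Qed.

Lemma hk_genC t A : F t A -> F t (~` A).
Proof. exact: (@measurableC _ (g_sigma_algebraType (hk_gen t))). Qed.

Lemma hk_genT t : F t setT.
Proof. exact: (@measurableT _ (g_sigma_algebraType (hk_gen t))). Qed.

Lemma hk_gen0 t : F t set0.
Proof. exact: (@measurable0 _ (g_sigma_algebraType (hk_gen t))). Qed.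

Lemma hk_gen_bigcup t (D : set nat) (A : nat -> set T) :
  (forall k, D k -> F t (A k)) -> F t (\bigcup_(k in D) A k).
Proof. exact: (@bigcup_measurable _ (g_sigma_algebraType (hk_gen t))). Qed.

Lemma hk_gen_bigcap t (D : set nat) (A : nat -> set T) :
  (forall k, D k -> F t (A k)) -> F t (\bigcap_(k in D) A k).
Proof. exact: (@bigcap_measurableType _ (g_sigma_algebraType (hk_gen t))). Qed.

Definition adapted (G : set ('I_n -> R)) := forall t, F t [set w | G (X t w)].

Lemma adapted_box lo hi : adapted (box lo hi).
Proof.
move=> t; apply: (@measurable_box _ _ _ (g_sigma_algebraType (hk_gen t))).
by move=> i; exact: traj_adapted.
Qed.

Lemma adapted_diam_le c : adapted [set x | diam x <= c].
Proof.
move=> t; apply: (@measurable_diam_le _ _ _ (g_sigma_algebraType (hk_gen t))).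
by move=> i; exact: traj_adapted.
Qed.

Lemma adapted_diam_ge c : adapted [set x | c <= diam x].
Proof.
move=> t; apply: (@measurable_diam_ge _ _ _ (g_sigma_algebraType (hk_gen t))).
by move=> i; exact: traj_adapted.
Qed.

(** The window of [hits] contains its starting time and that of [nohit] does not, as $\tau_k$ asks
    for $s>\tau_{k-1}$; so [hits G m.+1 L] and [nohit G m L.+1] are complementary. *)
Definition hits (G : set ('I_n -> R)) (t L : nat) : set T :=
  [set w | exists2 u, (u <= L)%N & G (X (t + u) w)].

Definition nohit (G : set ('I_n -> R)) (m l : nat) : set T :=
  [set w | forall u, (m < u <= m + l)%N -> ~ G (X u w)].

Lemma hits_adapted G t L : adapted G -> F (t + L) (hits G t L).
Proof.
move=> aG; have -> : hits G t L =
    \bigcup_(u in [set u | (u <= L)%N]) [set w | G (X (t + u) w)].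
  by apply/seteqP; split => w [u uL Gu]; exists u.
apply: hk_gen_bigcup => u /= uL; apply: hk_gen_mono (aG (t + u)%N).
by rewrite leq_add2l.
Qed.

Lemma nohit_adapted G m l : adapted G -> F (m + l) (nohit G m l).
Proof.
move=> aG; have -> : nohit G m l =
    \bigcap_(u in [set u | (m < u <= m + l)%N]) ~` [set w | G (X u w)].
  by apply/seteqP; split => w H u Hu; exact: H.
apply: hk_gen_bigcap => u /= /andP[_ uL]; apply: hk_genC.
exact: hk_gen_mono (aG u).
Qed.

(* [D] records that the target was already reached: the noise boxes prescribed
   by [steers] then keep being used, although nothing is needed any more. *)
Lemma steers_hit (beta : R) G L lo hi t (B D : set T) :
  0 < beta -> 0 <= rho -> adapted G -> steers r om eta beta G L lo hi ->
  F t B -> F t D -> B `<=` D `|` [set w | box lo hi (X t w)] ->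
  (((rho * beta ^+ n) ^+ L)%:E * P B <= P (B `&` (D `|` hits G t L)))%E.
Proof.
move=> b0 rho0 aG; elim: L lo hi t B D => [|L IHL] lo hi t B D.
  move=> boxG FB FD Bsub; rewrite expr0 mul1e; apply: le_measure.
  - by rewrite inE; exact: hk_gen_measurable FB.
  - rewrite inE; apply: (@hk_gen_measurable (t + 0)).
    apply: hk_genI; first by rewrite addn0.
    by apply: hk_genU; [rewrite addn0|exact: hits_adapted].
  - move=> w Bw; split=> //; case: (Bsub _ Bw) => [|xb]; first by left.
    by right; exists 0%N => //; rewrite addn0; exact: boxG.
move=> [a [lo' [hi' [aok step HL]]]] FB FD Bsub.
(* States already in [G] join the record, since the steering step promises nothing about them. *)
pose D' := D `|` [set w | G (X t w)].
pose C := B `&` (D' `|` [set w | box lo' hi' (X t.+1 w)]).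
have FD' : F t D' by apply: hk_genU.
have FC : F t.+1 C.
  apply: hk_genI; first exact: hk_gen_mono FB.
  by apply: hk_genU; [exact: hk_gen_mono FD'|exact: adapted_box].
have PC : ((rho * beta ^+ n)%:E * P B <= P C)%E.
  have ab i : - eta <= a i /\ a i < a i + beta /\ a i + beta <= eta.
    by have [? ?] := aok i; rewrite ltrDl.
  (* All sides equal [beta], so (A1) gives the factor $\underline\rho\beta^n$. *)
  have := A1 ab FB.
  rewrite (eq_bigr (fun=> beta)); last by move=> i _; rewrite addrAC subrr add0r.
  rewrite prodr_const card_ord => /le_trans; apply; apply: le_measure.
  - rewrite inE; apply: measurableI; last exact: hk_gen_measurable FB.
    exact: (@measurable_box _ _ _ _ (fun w => (xi t)^~ w)).
  - by rewrite inE; exact: hk_gen_measurable FC.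
  - move=> w [ew Bw]; split=> //; case: (Bsub _ Bw) => [|xb]; first by left; left.
    case: (pselect (G (X t w))) => Gw; first by left; right.
    by right; exact: step.
have CD : C `<=` D' `|` [set w | box lo' hi' (X t.+1 w)] by move=> w [].
have FD'' := hk_gen_mono (leqnSn t) FD'.
apply: (@le_trans _ _ (((rho * beta ^+ n) ^+ L)%:E * P C)%E).
  rewrite exprSr EFinM -muleA; apply: lee_wpmul2l => //.
  by rewrite lee_fin exprn_ge0// mulr_ge0// exprn_ge0// ltW.
apply: le_trans (IHL _ _ _ _ _ HL FC FD'' CD) _; apply: le_measure.
- rewrite inE; apply: (@hk_gen_measurable (t.+1 + L)); apply: hk_genI.
    by apply: hk_gen_mono FC; exact: leq_addr.
  apply: hk_genU; last exact: hits_adapted.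
  by apply: hk_gen_mono FD''; exact: leq_addr.
- rewrite inE; apply: (@hk_gen_measurable (t + L.+1)); apply: hk_genI.
    by apply: hk_gen_mono FB; exact: leq_addr.
  apply: hk_genU; last exact: hits_adapted.
  by apply: hk_gen_mono FD; exact: leq_addr.
- move=> w [[Bw _] Hw]; split=> //.
  case: Hw => [[Dw|Gw]|[u uL Gu]]; [by left|right|right].
    by exists 0%N; rewrite ?addn0.
  by exists u.+1 => //; rewrite addnS.
Qed.

Lemma nohit_catr G m k l :
  nohit G m (k + l) = nohit G m k `&` nohit G (m + k) l.
Proof.
apply/seteqP; split => [w H|w [H1 H2]].
  split=> u /andP[mu ul]; apply: H; apply/andP; split=> //.
  - by rewrite addnA (leq_trans ul)// leq_addr.
  - by rewrite (leq_ltn_trans _ mu)// leq_addr.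
  - by rewrite addnA.
move=> u /andP[mu ul]; case: (leqP u (m + k)) => umk.
  by apply: H1; rewrite mu.
by apply: H2; rewrite umk -addnA.
Qed.

(** A bound $1-\lambda$ on the conditional probability of missing [G], given the past at any time,
    tested on the events of the past instead of using conditional expectations. *)
Definition hit_rate (G : set ('I_n -> R)) (lam : R) (N : nat) :=
  forall m B, F m B -> (P (B `&` nohit G m N) <= (1 - lam)%:E * P B)%E.

(** Every state lies in $[0,1]^n$, so the steering can start at time $m+1$ whatever the past; it
    uses the times $m+1,\dots,m+1+L$. *)
Lemma steers_hit_rate (beta lam : R) G L :
  0 < beta -> 0 <= rho -> adapted G ->
  steers r om eta beta G L (cst 0) (cst 1) ->
  lam <= (rho * beta ^+ n) ^+ L -> hit_rate G lam L.+1.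
Proof.
move=> b0 rho0 aG HL lamq m B FB.
have FB' : F m.+1 B by exact: hk_gen_mono FB.
have mB := hk_gen_measurable FB.
have mH : measurable (hits G m.+1 L).
  by apply: (@hk_gen_measurable (m.+1 + L)); exact: hits_adapted.
have Bsub : B `<=` set0 `|` [set w | box (cst 0) (cst 1) (X m.+1 w)].
  by move=> w _; right; exact: traj_box.
have := steers_hit b0 rho0 aG HL FB' (@hk_gen0 m.+1) Bsub.
rewrite set0U => hitP.
have le1 : (P (B `&` nohit G m L.+1) <= P (B `\` hits G m.+1 L))%E.
  apply: le_measure; rewrite ?inE.
  - apply: measurableI => //; apply: (@hk_gen_measurable (m + L.+1)).
    exact: nohit_adapted.
  - exact: measurableD.
  - move=> w [Bw Nw]; split=> // -[u uL]; rewrite addSnnS; apply: Nw.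
    by rewrite -[in X in (X < _)%N](addn0 m) ltn_add2l leq_add2l ltnS.
apply: le_trans le1 _.
have fB : P B \is a fin_num by rewrite fin_num_measure.
have fH : P (B `&` hits G m.+1 L) \is a fin_num.
  by rewrite fin_num_measure//; exact: measurableI.
have pB : 0 <= fine (P B) by rewrite fine_ge0.
have -> : P (B `\` hits G m.+1 L) =
    (fine (P B) - fine (P (B `&` hits G m.+1 L)))%:E.
  by rewrite EFinB !fineK// measureD// ltey_eq fB.
rewrite -[X in (_ <= _ * X)%E](fineK fB) -EFinM lee_fin.
have {}hitP : (rho * beta ^+ n) ^+ L * fine (P B) <=
    fine (P (B `&` hits G m.+1 L)) by rewrite -lee_fin EFinM (fineK fB) (fineK fH).
have : lam * fine (P B) <= (rho * beta ^+ n) ^+ L * fine (P B).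
  by rewrite ler_wpM2r.
lra.
Qed.

(** Lets the two alternating targets share one rate and one window length. *)
Lemma hit_rateW G lam lam' N N' : adapted G -> lam' <= lam -> (N <= N')%N ->
  hit_rate G lam N -> hit_rate G lam' N'.
Proof.
move=> aG ll NN H m B FB; have mB := hk_gen_measurable FB.
have mN l : measurable (B `&` nohit G m l).
  apply: measurableI => //; apply: (@hk_gen_measurable (m + l)).
  exact: nohit_adapted.
apply: (@le_trans _ _ (P (B `&` nohit G m N))).
  apply: le_measure; rewrite ?inE// => w [Bw Nw]; split=> // u /andP[mu un].
  by apply: Nw; rewrite mu (leq_trans un)// leq_add2l.
apply: le_trans (H _ _ FB) _; apply: lee_wpmul2r => //.
by rewrite lee_fin; lra.
Qed.

(** Having missed [G] in the first [j] windows is an event of the past at $m+jN$, to which the rate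
    applies again. *)
Lemma hit_rate_iter G lam N m B j : adapted G -> lam <= 1 -> hit_rate G lam N ->
  F m B -> (P (B `&` nohit G m (j * N)) <= ((1 - lam) ^+ j)%:E * P B)%E.
Proof.
move=> aG lam1 H FB; elim: j => [|j IHj].
  rewrite expr0 mul1e; apply: le_measure; rewrite ?inE; last exact: subIsetl.
    apply: measurableI; first exact: hk_gen_measurable FB.
    by apply: (@hk_gen_measurable (m + 0 * N)); exact: nohit_adapted.
  exact: hk_gen_measurable FB.
rewrite mulSn addnC nohit_catr setIA; apply: le_trans (H _ _ _) _.
  by apply: hk_genI; [apply: hk_gen_mono FB; exact: leq_addr|exact: nohit_adapted].
by rewrite exprS EFinM -muleA lee_wpmul2l// lee_fin subr_ge0.
Qed.

Lemma hit_rate_after_negligible G lam N m : adapted G -> 0 < lam <= 1 ->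
  hit_rate G lam N -> P.-negligible [set w | forall u, (m < u)%N -> ~ G (X u w)].
Proof.
move=> aG /andP[lam0 lam1] H.
have mM : measurable [set w | forall u, (m < u)%N -> ~ G (X u w)].
  rewrite (_ : [set w | _] =
      \bigcap_(u in [set u | (m < u)%N]) ~` [set w | G (X u w)]).
    apply: bigcap_measurableType => u _; apply: measurableC.
    exact: hk_gen_measurable (aG u).
  by apply/seteqP; split => w Hw u Hu; exact: Hw.
apply/negligibleP => //; apply: (@le_exprn_eq0 _ (1 - lam)) => [||j] //; first lra.
have := hit_rate_iter j aG lam1 H (@hk_genT m).
rewrite probability_setT mule1 => /(le_trans _); apply; apply: le_measure.
- by rewrite inE.
- rewrite inE setTI; apply: (@hk_gen_measurable (m + j * N)).
  exact: nohit_adapted.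
- by move=> w Hw; split=> // u /andP[/Hw].
Qed.

Lemma hit_rate_io G lam N : adapted G -> 0 < lam <= 1 -> hit_rate G lam N ->
  {ae P, forall w, forall m, exists2 u, (m < u)%N & G (X u w)}.
Proof.
move=> aG lam01 H; apply: ae_foralln => m.
apply: negligibleS (hit_rate_after_negligible m aG lam01 H) => w /= noG u mu Gu.
by apply: noG; exists u.
Qed.

(** * The alternating hitting times and their tails *)

Variables (alpha c : R).

Definition target (k : nat) : set ('I_n -> R) :=
  if odd k then [set x | diam x <= alpha] else [set x | c <= diam x].

Lemma target_adapted k : adapted (target k).
Proof.
rewrite /target; case: odd; first exact: adapted_diam_le.
exact: adapted_diam_ge.
Qed.

Let tau w k := hk_tau (fun s => diam (X s w)) alpha c k.

Lemma tauS_some w k u : tau w k.+1 = Some u <->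
  exists s, [/\ tau w k = Some s, (s < u)%N, target k.+1 (X u w) &
    forall v, (s < v < u)%N -> ~ target k.+1 (X v w)].
Proof.
rewrite /target /tau /=; case: hk_tau => [s|]; last by split=> // -[s []].
case: (~~ odd k); rewrite first_after_someP; split.
- by move=> [su Gu Gv]; exists s; split=> // v /Gv /negP.
- by move=> [_ [[<-] su Gu Gv]]; split=> // v /Gv /negP.
- by move=> [su Gu Gv]; exists s; split=> // v /Gv /negP.
- by move=> [_ [[<-] su Gu Gv]]; split=> // v /Gv /negP.
Qed.

Lemma tauS_le w k s v : tau w k = Some s -> (s < v)%N -> target k.+1 (X v w) ->
  exists2 u, tau w k.+1 = Some u & (u <= v)%N.
Proof.
rewrite /target /tau /= => -> sv; case: (~~ odd k) => Gv;
  by apply: first_after_le.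
Qed.

(** $\tau_k$ is a stopping time: split by the value $s$ of $\tau_{k-1}$, then ask for no hit at
    times $s+1,\dots,m-1$ and a hit at $m$. *)
Lemma tau_adapted k m : F m [set w | tau w k = Some m].
Proof.
elim: k m => [|k IHk] m.
  have [->|m0] := eqVneq m 0%N.
    by rewrite (_ : [set w | _] = setT)//; [exact: hk_genT|exact/seteqP].
  rewrite (_ : [set w | _] = set0)//; first exact: hk_gen0.
  by apply/seteqP; split => // w [] /esym/eqP; rewrite (negbTE m0).
rewrite (_ : [set w | _] = \bigcup_(s in [set s | (s < m)%N])
   ([set w | tau w k = Some s] `&` nohit (target k.+1) s (m.-1 - s)
    `&` [set w | target k.+1 (X m w)])).
  apply: hk_gen_bigcup => s /= sm; apply: hk_genI; last exact: target_adapted.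
  apply: hk_genI; first by apply: hk_gen_mono (IHk s); exact: ltnW.
  have := @nohit_adapted (target k.+1) s (m.-1 - s) (@target_adapted k.+1); apply: hk_gen_mono.
  by case: m sm => // m sm; rewrite /= subnKC.
apply/seteqP; split => w.
  move=> /tauS_some[s [ts sm Gm noG]]; exists s => //; split=> //; split=> //.
  move=> u /andP[su um]; apply: noG; rewrite su.
  by case: m sm {Gm} um => // m sm; rewrite /= subnKC.
move=> [s /= sm [[ts noG] Gm]]; apply/tauS_some; exists s; split=> // v.
move=> /andP[sv vm]; apply: noG; rewrite sv /=.
by case: m sm {Gm} vm => // m sm; rewrite /= subnKC.
Qed.

(** The event $\tau_{k+1}-\tau_k>t$; the negated form makes infinite times count as late. *)
Let late k (t : R) := [set w | ~ exists s u : nat,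
  tau w k = Some s /\ tau w k.+1 = Some u /\ (u - s)%:R <= t].

Let infinite k := [set w | tau w k = None].

Lemma measurable_tau k m : measurable [set w | tau w k = Some m].
Proof. exact: (@hk_gen_measurable m _ (@tau_adapted k m)). Qed.

Lemma measurable_infinite k : measurable (infinite k).
Proof.
rewrite (_ : infinite k = ~` \bigcup_m [set w | tau w k = Some m]).
  by apply: measurableC; apply: bigcupT_measurable => m; exact: measurable_tau.
apply/seteqP; split => [w /= tN [m _ /=]|w /= tm]; first by rewrite tN.
by rewrite /infinite /=; case E : (tau w k) => [m|//]; case: tm; exists m.
Qed.

Lemma measurable_late k t : measurable (late k t).
Proof.
rewrite (_ : late k t = ~` \bigcup_s \bigcup_(u in [set u | (u - s)%:R <= t])
   ([set w | tau w k = Some s] `&` [set w | tau w k.+1 = Some u])).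
  apply: measurableC; apply: bigcupT_measurable => s.
  by apply: bigcup_measurable => u _; apply: measurableI; exact: measurable_tau.
congr (~` _); apply/seteqP; split => [w [s [u [ts [tu us]]]]|w].
  by exists s => //; exists u.
by move=> [s _ [u us [ts tu]]]; exists s, u.
Qed.

Variables (lam : R) (N : nat).
Hypotheses (lam01 : 0 < lam < 1) (N_gt0 : (0 < N)%N).
Hypothesis rate : forall k, hit_rate (target k) lam N.

Let lamW : lam <= 1. Proof. by have /andP[_ /ltW] := lam01. Qed.

Lemma late_sub k t j : (j * N)%:R <= t -> late k t `<=` infinite k `|`
  \bigcup_s ([set w | tau w k = Some s] `&` nohit (target k.+1) s (j * N)).
Proof.
move=> jt w lw; case E : (tau w k) => [s|]; last by left.
right; exists s => //; split=> // v /andP[sv vj] Gv; apply: lw.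
have [u tu uv] := tauS_le E sv Gv; exists s, u; split=> //; split=> //.
by apply: le_trans jt; rewrite ler_nat leq_subLR (leq_trans uv).
Qed.

(** Conditioning on $\tau_k=s$, an event of the past at $s$, costs a factor $(1-\lambda)^j$; the
    events $\tau_k=s$ are disjoint, so their masses sum to at most 1. *)
Lemma late_le k t j : (j * N)%:R <= t -> P (infinite k) = 0%E ->
  (P (late k t) <= ((1 - lam) ^+ j)%:E)%E.
Proof.
move=> jt inf0.
pose A s := [set w | tau w k = Some s].
pose E s := A s `&` nohit (target k.+1) s (j * N).
have mA s : measurable (A s) by exact: measurable_tau.
have mE s : measurable (E s).
  apply: measurableI => //; apply: (@hk_gen_measurable (s + j * N)).
  by apply: nohit_adapted; exact: target_adapted.
have mEE : measurable (\bigcup_s E s) by exact: bigcupT_measurable.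
apply: (@le_trans _ _ (P (infinite k `|` \bigcup_s E s))).
  apply: le_measure; rewrite ?inE; [exact: measurable_late| |exact: late_sub].
  by apply: measurableU => //; exact: measurable_infinite.
apply: (@le_trans _ _ (P (infinite k) + P (\bigcup_s E s))%E).
  by apply: measureU2 => //; exact: measurable_infinite.
rewrite inf0 add0e; apply: le_trans (le_mu_bigcup _ mE mEE) _.
apply: (@le_trans _ _ (\sum_(0 <= s <oo) (((1 - lam) ^+ j)%:E * P (A s)))%E).
  apply: lee_nneseries => // s _.
  exact: hit_rate_iter (@target_adapted k.+1) lamW (rate k.+1) (@tau_adapted k s).
rewrite nneseriesZl// -measure_semi_bigcup//.
- rewrite -[leRHS]mule1; apply: lee_wpmul2l.
    by rewrite lee_fin exprn_ge0// subr_ge0.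
  by apply: probability_le1; exact: bigcupT_measurable.
- by move=> s s' _ _ [w [ts ts']]; apply: Some_inj; rewrite -ts -ts'.
- exact: bigcupT_measurable.
Qed.

(** By induction: if $\tau_{k+1}$ is infinite, the step after $\tau_k$ is late for every $t=jN$. *)
Lemma infinite_eq0 k : P (infinite k) = 0%E.
Proof.
elim: k => [|k IHk].
  by rewrite (_ : infinite 0 = set0) ?measure0//; by apply/seteqP; split=> w.
have /andP[lam0 lam1] := lam01.
apply: (@le_exprn_eq0 _ (1 - lam)) => [||j] //; first lra.
apply: le_trans (late_le (lexx _) IHk); apply: le_measure; rewrite ?inE.
- exact: measurable_infinite.
- exact: measurable_late.
- by move=> w tN [s [u [_ []]]]; rewrite tN.
Qed.

Lemma late_tail k t : 0 <= t ->
  (P (late k t) <= ((1 - lam) ^+ Num.truncn (t / N%:R))%:E)%E.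
Proof.
move=> t0; apply: late_le (infinite_eq0 k).
by rewrite natrM -ler_pdivlMr ?ltr0n// truncn_le divr_ge0.
Qed.

End Process.

(** * Almost sure limsup bounds and geometric tails from the two steering results *)

Theorem theorem2 (R : realType) (n : nat) (r om : 'I_n -> R) (eta rho : R) :
  (3 <= n)%N ->
  (forall i, 0 < r i <= 1) ->
  (forall i, 0 < om i < 1) ->
  0 < eta -> 0 < rho ->
  rmin r < 1 ->
  (* almost sure behaviour of limsup d_V(t) *)
  (forall (d : measure_display) (T : measurableType d) (P : probability T R)
          (xi : nat -> 'I_n -> T -> R) (x0 : 'I_n -> R),
     (forall t i, measurable_fun setT (xi t i)) ->
     (forall t i w, - eta <= xi t i w <= eta) ->
     (forall i, 0 <= x0 i <= 1) ->
     (* assumption (A1), conditional on sigma(x(0), ..., x(t)) *)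
     (forall (t : nat) (a b : 'I_n -> R),
        (forall i, - eta <= a i /\ a i < b i /\ b i <= eta) ->
        forall B : set T,
          <<s [set A | exists (s : nat) (i : 'I_n) (U : set R),
                 (s <= t)%N /\ measurable U /\
                 A = (fun w => hk_traj r om x0 (fun u j => xi u j w) s i) @^-1` U] >> B ->
          ((rho * \prod_(i < n) (b i - a i))%:E * P B
             <= P ([set w | forall i, (a i <= xi t i w <= b i)%R] `&` B))%E) ->
     (eta <= rmin r / 2 ->
        {ae P, forall w,
          limn_esup (fun t => (diam (hk_traj r om x0 (fun u j => xi u j w) t))%:E)
            = (2 * eta)%:E}) /\
     (rmin r / 2 < eta ->
        {ae P, forall w,
          ((Num.min (c2 r om eta) 1)%:E <=
           limn_esup (fun t => (diam (hk_traj r om x0 (fun u j => xi u j w) t))%:E))%E}))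
  /\
  (* geometric tails of the alternating hitting times *)
  (forall alpha : R, 0 < alpha ->
   exists lam Lam : R, 0 < lam < 1 /\ 0 < Lam /\
   forall (d : measure_display) (T : measurableType d) (P : probability T R)
          (xi : nat -> 'I_n -> T -> R) (x0 : 'I_n -> R),
     (forall t i, measurable_fun setT (xi t i)) ->
     (forall t i w, - eta <= xi t i w <= eta) ->
     (forall i, 0 <= x0 i <= 1) ->
     (forall (t : nat) (a b : 'I_n -> R),
        (forall i, - eta <= a i /\ a i < b i /\ b i <= eta) ->
        forall B : set T,
          <<s [set A | exists (s : nat) (i : 'I_n) (U : set R),
                 (s <= t)%N /\ measurable U /\
                 A = (fun w => hk_traj r om x0 (fun u j => xi u j w) s i) @^-1` U] >> B ->
          ((rho * \prod_(i < n) (b i - a i))%:E * P B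
             <= P ([set w | forall i, (a i <= xi t i w <= b i)%R] `&` B))%E) ->
     forall (k : nat) (t : R), 0 <= t ->
       (P [set w | let tau := hk_tau
                     (fun s => diam (hk_traj r om x0 (fun u j => xi u j w) s))
                     alpha (c3 r om eta alpha) in
                   ~ (exists s u : nat, tau k = Some s /\ tau k.+1 = Some u /\
                                         ((u - s)%:R <= t)%R)]
        <= ((1 - lam) ^+ (Num.truncn (t / Lam)))%:E)%E).
Proof.
move=> n3 r01 om01 eta0 rho0 _.
have q_gt0 (beta : R) L : 0 < beta -> 0 < (rho * beta ^+ n) ^+ L.
  by move=> b0; rewrite exprn_gt0// mulr_gt0// exprn_gt0.
split=> [d T P xi x0 mxi xib x01 A1|alpha a0].
  pose X t w := hk_traj r om x0 (fun u j => xi u j w) t.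
  have io (G : set ('I_n -> R)) beta L : 0 < beta ->
      @adapted _ _ r om _ _ xi x0 G ->
      steers r om eta beta G L (cst 0) (cst 1) ->
      {ae P, forall w, forall m, exists2 u, (m < u)%N & G (X u w)}.
    move=> b0 aG HL.
    have H := steers_hit_rate mxi x01 A1 b0 (ltW rho0) aG HL (lexx _).
    (* [hit_rate_io] takes rates up to 1; a larger bound is weakened to 1. *)
    have [q1|/ltW q1] := leP ((rho * beta ^+ n) ^+ L) 1.
      by apply: hit_rate_io H => //; rewrite q_gt0.
    by apply: hit_rate_io (hit_rateW mxi aG q1 (leqnn _) H) => //; rewrite ltr01 lexx.
  (* Taking $\alpha=1/(j+1)$ leaves only countably many exceptional null sets. *)
  have lower c : (forall j : nat, c - j.+1%:R^-1 <= c3 r om eta j.+1%:R^-1) ->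
      {ae P, forall w, (c%:E <= limn_esup (fun t => (diam (X t w))%:E))%E}.
    move=> cc3.
    have : {ae P, forall w, forall j m : nat,
        exists2 u, (m < u)%N & c3 r om eta j.+1%:R^-1 <= diam (X u w)}.
      apply: ae_foralln => j.
      have j0 : 0 < (j.+1%:R^-1 : R) by rewrite invr_gt0.
      have [beta [L [b0 HL]]] := steers_spread n3 r01 om01 eta0 j0.
      exact: io b0 (adapted_diam_ge _) HL.
    apply: filterS => w Hw; apply/lee_subgt0Pr => e e0.
    have [j je] := natr_mul_ge 1 e0.
    apply: limn_esup_ge => m; have [u mu cu] := Hw j m; exists u => //.
    apply: le_trans cu; apply: le_trans (cc3 j).
    rewrite lerD2l lerN2 -[leLHS]mul1r ler_pdivrMr ?ltr0n// mulrC.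
    by apply: le_trans je _; rewrite ler_pM2r// ler_nat.
  split=> re; last first.
    apply: lower => j; have j0 : 0 <= (j.+1%:R^-1 : R) by rewrite invr_ge0.
    rewrite /c3 [eta <= _]leNgt re /= le_min lerD2r ge_min lexx /=.
    by rewrite lerBlDr ge_min; apply/orP; right; rewrite lerDl.
  have rmin0 : 0 < rmin r.
    by apply/bigmin_gtP; split=> // i _; have /andP[] := r01 i.
  have ge2 : {ae P, forall w,
      ((2 * eta)%:E <= limn_esup (fun t => (diam (X t w))%:E))%E}.
    by apply: lower => j; rewrite /c3 re.
  (* Consensus up to [rmin] is reached at some time [u]; from $u+1$ on the diameter stays at most
     $2\eta\le r_{\min}$. *)
  have [beta [L [b0 HL]]] := steers_consensus r01 om01 eta0 rmin0.
  have := io _ _ _ b0 (adapted_diam_le _) HL.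
  apply: filterS2 ge2 => w ge2 /(_ 0%N)[u _ /= du].
  have stay v : diam (X (u + v.+1)%N w) <= 2 * eta.
    elim: v => [|v IHv]; rewrite addnS; apply: diam_step_le (ltW eta0) _ => //.
      by rewrite addn0.
    by apply: le_trans IHv _; lra.
  apply/eqP; rewrite eq_le ge2 andbT; apply: (@limn_esup_le _ _ _ u.+1) => v uv.
  by rewrite -(subnKC uv) addSnnS; exact: stay.
have [b1 [L1 [b10 HL1]]] := steers_consensus r01 om01 eta0 a0.
have [b2 [L2 [b20 HL2]]] := steers_spread n3 r01 om01 eta0 a0.
pose q1 := (rho * b1 ^+ n) ^+ L1; pose q2 := (rho * b2 ^+ n) ^+ L2.
(* The cap $1/2$ ensures $\lambda<1$; the minimum and the maximum serve both parities. *)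
pose lam := Num.min (Num.min q1 q2) 2^-1; pose N := maxn L1.+1 L2.+1.
have lam01 : 0 < lam < 1.
  rewrite !lt_min !q_gt0//= gt_min; apply/andP; split; first lra.
  by apply/orP; right; lra.
have N0 : (0 < N)%N by rewrite leq_max.
exists lam, N%:R; split=> //; split; first by rewrite ltr0n.
move=> d T P xi x0 mxi xib x01 A1 k t t0.
apply: (late_tail mxi lam01 N0) t0 => {}k.
have aT := @target_adapted _ _ r om _ _ xi x0 alpha (c3 r om eta alpha) k.
rewrite /target in aT *; case: odd in aT *.
  apply: (@hit_rateW _ _ _ _ _ _ _ _ _ mxi _ q1 _ L1.+1) => //.
  - by rewrite /lam !ge_min lexx.
  - by rewrite leq_max leqnn.
  - exact (steers_hit_rate mxi x01 A1 b10 (ltW rho0) aT HL1 (lexx _)).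
apply: (@hit_rateW _ _ _ _ _ _ _ _ _ mxi _ q2 _ L2.+1) => //.
- by rewrite /lam !ge_min lexx orbT.
- by rewrite leq_max leqnn orbT.
- exact (steers_hit_rate mxi x01 A1 b20 (ltW rho0) aT HL2 (lexx _)).
Qed.
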